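(* For every $\epsilon>0$, there exists a positive integer $n$ such that any (one-pass streaming) algorithm that $(\epsilon,\rho)$-approximates a convex polygon $\mathcal{K}$ requires $\Omega\left(\frac{1}{\sqrt{\epsilon}}\right)$ bits of space, where $\mathcal{K}$ is given as a stream of at most $2n$ straight lines in $\mathbb{R}^2$.
   Context: A convex body $\mathcal{K}$ is said to be $\epsilon$-approximated by a convex body $\mathcal{K}'$ if $d_H(\mathcal{K},\mathcal{K}') \le \epsilon$, where $d_H$ is the Hausdorff distance; the diameter of $\mathcal{K}$ is bounded by $1$. An algorithm $(\epsilon,\rho)$-approximates $\mathcal{K}$ if, with probability at least $1-\rho$, it produces (stores a representation of) a convex body $\mathcal{K}'$ that $\epsilon$-approximates $\mathcal{K}$; here $\rho=\frac13$. The polygon $\mathcal{K}$ is presented by the stream of the lines supporting its edges ($\mathcal{K}$ is the intersection of the corresponding half-planes). A one-pass (insertion-only) streaming algorithm reads the lines once in order and keeps only a memory state, whose size in bits is the space. The constant in $\Omega(\cdot)$ is absolute. *)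

(* Defs.v *)
(* MathComp / MathComp-Analysis *)
From HB Require Import structures.
From mathcomp Require Export all_boot all_order all_algebra.
From mathcomp Require Export all_classical all_reals all_analysis.
Export numFieldNormedType.Exports.

Set Implicit Arguments.
Unset Strict Implicit.
Unset Printing Implicit Defensive.

Import Order.TTheory GRing.Theory Num.Theory.

Local Open Scope classical_set_scope.
Local Open Scope ring_scope.

Notation plane R := 'rV[R]_2.

Section Geometry.
Context {R : realType}.
Implicit Types (u p q : plane R) (A B K H l : set (plane R)).

Definition dot u p : R := \sum_(i < 2) u ord0 i * p ord0 i.

(* The norm the library puts on 'rV[R]_2 is the max norm, hence this one. *)
Definition edistance p q : R := Num.sqrt (dot (p - q) (p - q)).

Definition edisc p (r : R) : set (plane R) := [set q | edistance p q <= r].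

Definition diameter A : \bar R :=
  ereal_sup [set (edistance z.1 z.2)%:E | z in A `*` A].

Definition dist_to_set p A : \bar R :=
  ereal_inf [set (edistance p q)%:E | q in A].

Definition hausdorff A B : \bar R :=
  maxe (ereal_sup [set dist_to_set a B | a in A])
       (ereal_sup [set dist_to_set b A | b in B]).

Definition convex_body K : Prop :=
  [/\ compact K, convex_set K & K° !=set0].

(* The convex body K is eps-approximated by the convex body K'. *)
Definition eps_approximated (eps : R) K K' : Prop :=
  convex_body K' /\ (hausdorff K K' <= eps%:E)%E.

(* H is one of the two closed half-planes bounded by the straight line l. *)
Definition halfplane_of l H : Prop :=
  exists u (c : R),
    [/\ u != 0, l = [set p | dot u p = c] & H = [set p | dot u p <= c]].

(* L lists the supporting lines of the edges of the convex polygon K, each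
   once and in arbitrary order. The lines carry no orientation: the side on
   which K lies is not part of the data. *)
Definition edge_lines (L : seq (set (plane R))) K : Prop :=
  [/\ convex_body K,
      uniq L,
      (exists H : set (plane R) -> set (plane R),
         (forall l, l \in L -> halfplane_of l (H l)) /\
         K = \bigcap_(l in [set` L]) H l)
    & (forall l, l \in L -> exists p q, [/\ p != q, (l `&` K) p & (l `&` K) q])].

End Geometry.

(* One-pass algorithm with s bits of memory. Only the memory state is passed
   from one line to the next. All the random coins are drawn beforehand, as a
   point w of a probability space; neither they nor the step number i are
   charged. Fresh coins at each line and one reusable random string are both
   special cases. *)
Record stream_alg (R : realType) (W : Type) (s : nat) := StreamAlg {
  sa_init : W -> s.-tuple bool;
  sa_step : nat -> W -> s.-tuple bool -> set (plane R) -> s.-tuple bool;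
  sa_output : W -> s.-tuple bool -> set (plane R) }.

Section Algorithms.
Context {R : realType} {W : Type} {s : nat}.
Implicit Types (A : stream_alg R W s) (L : seq (set (plane R))).

Fixpoint sa_run A (w : W) (i : nat) (m : s.-tuple bool) L : s.-tuple bool :=
  if L is l :: L' then sa_run A w i.+1 (sa_step A i w m l) L' else m.

Definition sa_result A (w : W) L : set (plane R) :=
  sa_output A w (sa_run A w 0 (sa_init A w) L).

End Algorithms.

(* A (eps, rho)-approximates every convex polygon K of diameter at most 1 in
   the domain D that has at most N edges, in whatever order its edge lines
   arrive. No measurability is imposed on A: the success set only has to
   contain an event of probability at least 1 - rho. *)
Definition approximates_polygons (R : realType) (d : measure_display)
    (W : measurableType d) (P : probability W R) (s : nat)
    (A : stream_alg R W s) (eps rho : R) (D : set (set (plane R))) (N : nat) :=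
  forall (K : set (plane R)) (L : seq (set (plane R))),
    D K -> (diameter K <= 1)%E -> edge_lines L K -> (size L <= N)%N ->
    exists2 E : set W, measurable E /\ ((1 - rho)%:E <= P E)%E
      & E `<=` [set w | eps_approximated eps K (sa_result A w L)].

(* The domain of inputs on which an algorithm must be correct. It may be all
   of the convex bodies (D = setT), but demanding only the bodies that contain a
   fixed disc keeps the lower bound meaningful: with lines of infinite
   precision, arbitrarily far or arbitrarily thin polygons defeat every finite
   memory for reasons unrelated to 1 / sqrt eps. *)
Definition covers_fat_bodies (R : realType) (D : set (set (plane R))) : Prop :=
  forall K, convex_body K -> edisc 0 4^-1 `<=` K -> D K.

Lemma covers_fat_bodies_setT (R : realType) : @covers_fat_bodies R setT.
Proof. by []. Qed.

(* Main.v *)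
(** For a finite nonempty set [T] of abscissae in ]-1/4, 1/4[, let [arch T] be
    the part of the box [|x| <= 1/4], [-1/4 <= y] that lies below the tangents to
    the parabola [y = 5/16 - x^2] at the points of [T]. The tangent at [t] lies
    [(x - t)^2] above the parabola, so if the abscissae are taken among points
    [gap] apart, every tangent carries an edge, and two different arches are
    more than [2 eps] apart in Hausdorff distance as soon as [gap ^ 2 > 3 eps].
    There is room for about [1 / sqrt eps] such points. Averaging over
    the coins, some fixed coins make the algorithm succeed on two thirds of the
    nonempty subsets; as no body approximates two different arches, it must
    end in different memory states on them, whatever the order of the
    lines. Hence [2 ^ s >= 2/3 * (2 ^ (m + 1) - 1)], that is [m <= s], for
    [m + 1] points. *)

Require Import Defs.
From mathcomp Require Import measurable_realfun.
From mathcomp Require Import ring lra zify.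

Set Implicit Arguments.
Unset Strict Implicit.
Unset Printing Implicit Defensive.

Import Order.TTheory GRing.Theory Num.Theory.

Local Open Scope classical_set_scope.
Local Open Scope ring_scope.

(** * Euclidean geometry of the plane and Hausdorff distance *)

Section Plane.
Context {R : realType}.
Implicit Types (u v p q : plane R) (A B K : set (plane R)).

Definition pt (x y : R) : plane R := \row_j (if j == ord0 then x else y).

Lemma ptE0 x y : pt x y ord0 ord0 = x.
Proof. by rewrite mxE. Qed.

Lemma ptE1 x y : pt x y ord0 ord_max = y.
Proof. by rewrite mxE. Qed.

Lemma dotE u p : dot u p = u ord0 ord0 * p ord0 ord0 + u ord0 ord_max * p ord0 ord_max.
Proof.
rewrite /dot !big_ord_recl big_ord0 addr0.
by rewrite (_ : lift ord0 ord0 = ord_max)//; exact: val_inj.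
Qed.

Lemma planeP u v : u ord0 ord0 = v ord0 ord0 -> u ord0 ord_max = v ord0 ord_max -> u = v.
Proof.
move=> uv0 uv1; apply/rowP => -[[|[|//]] i2].
- by rewrite (_ : Ordinal i2 = ord0)//; exact: val_inj.
- by rewrite (_ : Ordinal i2 = ord_max)//; exact: val_inj.
Qed.

Lemma dotC u v : dot u v = dot v u.
Proof. by rewrite !dotE; ring. Qed.

Lemma dotDr u p q : dot u (p + q) = dot u p + dot u q.
Proof. by rewrite !dotE !mxE; ring. Qed.

Lemma dotBr u p q : dot u (p - q) = dot u p - dot u q.
Proof. by rewrite !dotE !mxE; ring. Qed.

Lemma dotZr u (a : R) p : dot u (a *: p) = a * dot u p.
Proof. by rewrite !dotE !mxE; ring. Qed.

Lemma dot0 u : dot u 0 = 0.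
Proof. by rewrite !dotE !mxE; ring. Qed.

Lemma dotvv_ge0 u : 0 <= dot u u.
Proof. by rewrite dotE -!expr2 addr_ge0 ?sqr_ge0. Qed.

Lemma dotvv_eq0 u : dot u u = 0 -> u = 0.
Proof.
rewrite dotE -!expr2 => /eqP; rewrite paddr_eq0 ?sqr_ge0// !sqrf_eq0.
by case/andP => /eqP u0 /eqP u1; apply: planeP; rewrite mxE.
Qed.

(** Cauchy-Schwarz, through Lagrange's identity: the defect is the square of a determinant. *)
Lemma dot_le_edistance u p q : dot u (p - q) <= Num.sqrt (dot u u) * edistance p q.
Proof.
rewrite /edistance -sqrtrM ?dotvv_ge0//.
apply: le_trans (ler_norm _) _; rewrite -sqrtr_sqr ler_wsqrtr//.
rewrite -subr_ge0 !dotE.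
set a := u _ _; set b := u _ _; set c := (p - q) _ _; set d := (p - q) _ _.
suff -> : (a * a + b * b) * (c * c + d * d) - (a * c + b * d) ^+ 2 =
  (a * d - b * c) ^+ 2 by exact: sqr_ge0.
by ring.
Qed.

Lemma dot_continuous u : continuous (dot u : plane R -> R).
Proof.
move=> p; have -> : dot u = (fun p => u ord0 ord0 * p ord0 ord0 +
    u ord0 ord_max * p ord0 ord_max) :> (plane R -> R).
  by apply/funext => q; exact: dotE.
have coordM a i : {for p, continuous (fun q : plane R => a * q ord0 i)}.
  by apply: (@cvgMl_tmp R (plane R) (nbhs p)); exact: coord_continuous.
exact: (@continuousD R R^o (plane R) _ _ p (coordM _ _) (coordM _ _)).
Qed.

(** The infimum need not be attained, hence the slack between [e] and [r]. *)
Lemma dist_to_set_lt p A (e r : R) : (dist_to_set p A <= e%:E)%E -> e < r ->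
  exists2 q, A q & edistance p q < r.
Proof.
move=> pA er; have : (dist_to_set p A < r%:E)%E by rewrite (le_lt_trans pA)// lte_fin.
by case/ereal_inf_lt => _ [q Aq <-]; rewrite lte_fin; exists q.
Qed.

Lemma hausdorff_lt A B (e r : R) : (hausdorff A B <= e%:E)%E -> e < r ->
  (forall a, A a -> exists2 b, B b & edistance a b < r) /\
  (forall b, B b -> exists2 a, A a & edistance b a < r).
Proof.
rewrite ge_max => /andP[AB BA] er; split=> p Ap; apply: dist_to_set_lt er.
- by apply: le_trans AB; apply: ereal_sup_ubound; exists p.
- by apply: le_trans BA; apply: ereal_sup_ubound; exists p.
Qed.

(** From [p] one reaches a point of [K], then a point of [B], over a distance of about [2 * e]; on
    the way [dot u] drops by at most that distance times the norm of [u]. *)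
Lemma common_approx_separation (e c : R) A B K u p :
  eps_approximated e A K -> eps_approximated e B K ->
  A p -> (forall q, B q -> dot u q <= c) ->
  dot u p - c <= 2 * e * Num.sqrt (dot u u).
Proof.
move=> [_ AK] [_ BK] Ap Bc; apply/ler_addgt0Pr => d d0.
set N := Num.sqrt _; have N0 : 0 <= N by exact: sqrtr_ge0.
(* The slack is spent twice, and [2 * g * N <= d]; the [+ 1] covers [N = 0]. *)
pose g := d / (2 * (N + 1)).
have g0 : 0 < g by rewrite divr_gt0// mulr_gt0// ltr_wpDl.
have er : e < e + g by rewrite ltrDl.
have [k Kk pk] := (hausdorff_lt AK er).1 p Ap.
have [q Bq kq] := (hausdorff_lt BK er).2 k Kk.
have up := dot_le_edistance u p k; have uk := dot_le_edistance u k q.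
have uq := Bc _ Bq; rewrite !dotBr -/N in up uk.
have gN : 2 * g * (N + 1) = d.
  by rewrite /g; field; rewrite gt_eqF// ltr_wpDl.
have pN := ler_wpM2l N0 (ltW pk); have kN := ler_wpM2l N0 (ltW kq).
nra.
Qed.

End Plane.

(** * Polygons as polars of finite sets of vectors *)

Section Polygon.
Context {R : realType}.
Implicit Types (u v p q : plane R) (us : seq (plane R)).

(** A line that misses the origin has exactly one equation of this form, so one vector records both
    the line and its side containing the origin. *)
Definition polar_line u : set (plane R) := [set p | dot u p = 1].

Definition polar us : set (plane R) := [set p | forall u, u \in us -> dot u p <= 1].

(* Pairing [u] with the multiple of [v] lying on its line gives [dot u v = dot v v]. *)
Lemma polar_line_inj : injective polar_line.
Proof.
have key u v : polar_line u = polar_line v -> v != 0 -> dot u v = dot v v.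
  move=> uv v0; have vv0 : dot v v != 0 by apply: contra_neq v0 => /dotvv_eq0.
  have : polar_line v ((dot v v)^-1 *: v) by rewrite /polar_line /= dotZr mulVf.
  by rewrite -uv /polar_line /= dotZr => /(congr1 ( *%R (dot v v))); rewrite mulVKf// mulr1.
have key0 u : polar_line u = polar_line 0 -> u = 0.
  move=> u0; apply/eqP/negP => /negP un0.
  have uu0 : dot u u != 0 by apply: contra_neq un0 => /dotvv_eq0.
  have : polar_line u ((dot u u)^-1 *: u) by rewrite /polar_line /= dotZr mulVf.
  by rewrite u0 /polar_line /= dotC dot0 => /eqP; rewrite eq_sym oner_eq0.
move=> u v uv; have [v0|v0] := eqVneq v 0; first by subst v; exact: key0.
have [u0|u0] := eqVneq u 0; first by subst u; rewrite (key0 v).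
apply/eqP; rewrite -subr_eq0; apply/eqP/dotvv_eq0.
have uvE := key _ _ uv v0; have vuE := key _ _ (esym uv) u0.
by rewrite dotBr !(dotC (u - v)) !dotBr uvE vuE !subrr.
Qed.

Lemma polar_convex us : convex_set (polar us).
Proof.
move=> p q k; rewrite !inE => pu qu u uus.
rewrite [X in dot u X](_ : _ = k%:num *: p + (1 - k%:num) *: q)//.
rewrite dotDr !dotZr.
have := pu u uus; have := qu u uus; have k0 : 0 <= k%:num by [].
have k1 : k%:num <= 1 by [].
nra.
Qed.

Lemma polar_closed us : closed (polar us).
Proof.
have -> : polar us = \bigcap_(u in [set` us]) (dot u @^-1` [set x : R | x <= 1]).
  by apply/seteqP; split => p pus u; exact: pus.
apply: closed_bigI => u _.
by apply: preimage_closed; [move=> x _; exact: dot_continuous | exact: closed_le].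
Qed.

Lemma polar_compact us (r : R) :
  (forall p, polar us p -> `|p ord0 ord0| <= r /\ `|p ord0 ord_max| <= r) ->
  compact (polar us).
Proof.
move=> pr; apply: bounded_closed_compact; last exact: polar_closed.
exists r; split; first exact: num_real.
move=> x rx p /pr[p0 p1].
change (mx_norm p <= x); rewrite mx_normrE; apply/bigmax_leP; split => [|[i j] _ /=].
  by rewrite (le_trans _ (ltW rx))// (le_trans (normr_ge0 _) p0).
rewrite (ord1 i); case: (eqVneq j ord0) => [->|j0]; first exact: le_trans p0 (ltW rx).
rewrite (_ : j = ord_max); first exact: le_trans p1 (ltW rx).
by apply/val_inj; case: j j0 => -[|[|]].
Qed.

Lemma edisc_interior0 (r : R) K : 0 < r -> edisc (0 : plane R) r `<=` K -> K° 0.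
Proof.
(* The ball of the max norm is a square; with half-side [r / 2] it fits in the disc, as
   [2 * (r / 2) ^ 2 <= r ^ 2]. *)
move=> r0 rK; apply: (@filterS _ _ _ (ball 0 (r / 2))); last first.
  by apply: nbhsx_ballx; rewrite divr_gt0.
move=> p; rewrite mx_norm_ball /ball_ /= sub0r normrN => pr; apply: rK.
have coord j : `|p ord0 j| <= r / 2.
  apply: le_trans (ltW pr); change (`|p ord0 j| <= mx_norm p); rewrite mx_normrE.
  exact: (le_bigmax _ (fun ij => `|p ij.1 ij.2|) (ord0, j)).
rewrite /edisc /= /edistance sub0r -[leRHS]gtr0_norm// -sqrtr_sqr ler_wsqrtr//.
rewrite dotE !mxE !mulrNN -!expr2 -(real_normK (num_real (p ord0 ord0))).
rewrite -(real_normK (num_real (p ord0 ord_max))).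
have := coord ord0; have := coord ord_max.
have := normr_ge0 (p ord0 ord0); have := normr_ge0 (p ord0 ord_max).
by nra.
Qed.

Lemma polar_edge_lines us : convex_body (polar us) -> uniq us ->
  (forall u, u \in us -> exists p q,
     [/\ p != q, polar us p, polar us q, dot u p = 1 & dot u q = 1]) ->
  edge_lines (map polar_line us) (polar us).
Proof.
move=> cK uus pq; split => //.
- by rewrite (map_inj_uniq polar_line_inj).
(* The side must be a function of the line alone: quantifying over all [u] that define [l] avoids
   choosing one, and injectivity leaves only one. *)
- exists (fun l => [set p | forall u, l = polar_line u -> dot u p <= 1]); split.
    move=> _ /mapP[u /pq[p [q [_ _ _ up _]]] ->]; exists u, 1; split => //.
      by apply/eqP => u0; move: up; rewrite u0 dotC dot0 => /eqP; rewrite eq_sym oner_eq0.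
    by apply/seteqP; split => [z /(_ u erefl)//|z uz v /polar_line_inj <-].
  apply/seteqP; split => [z zK _ /= /mapP[u uus' ->] v /polar_line_inj <-|z zK u uus'].
    exact: zK.
  by apply: (zK (polar_line u)) => //=; exact: map_f.
- move=> _ /mapP[u /pq[p [q [pq' Kp Kq up uq]]] ->].
  by exists p, q; split.
Qed.

End Polygon.

(** * Arches: shape, edges and mutual separation *)

Section Arch.
Context {R : realType}.
Implicit Types (p : plane R) (t d : R) (T : seq R).

(* Normalized so that the half-plane below the tangent at [t] is [dot _ p <= 1]. *)
Definition tangent t : plane R := (5 / 16 + t ^+ 2)^-1 *: pt (2 * t) 1.

Definition arch_normals T : seq (plane R) :=
  [:: pt (- 4) 0; pt 4 0; pt 0 (- 4)] ++ map tangent T.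

Definition arch T : set (plane R) := polar (arch_normals T).

(** The margin at both ends keeps the edge around each tangency point inside the box. *)
Definition spaced d T :=
  (forall t, t \in T -> - 4^-1 + d <= t <= 4^-1 - d) /\
  (forall t t', t \in T -> t' \in T -> t != t' -> d <= `|t - t'|).

Lemma ler_sqr_norm (x y : R) : (x ^+ 2 <= y ^+ 2) = (`|x| <= `|y|).
Proof.
rewrite -(real_normK (num_real x)) -(real_normK (num_real y)).
by rewrite ler_sqr// nnegrE.
Qed.

Lemma tangent_den_gt0 t : 0 < 5 / 16 + t ^+ 2.
Proof. by have := sqr_ge0 t; lra. Qed.

Lemma dot_tangent t p : dot (tangent t) p =
  (2 * t * p ord0 ord0 + p ord0 ord_max) / (5 / 16 + t ^+ 2).
Proof. by rewrite dotC dotZr dotC dotE ptE0 ptE1 mul1r mulrC. Qed.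

(** Completing the square shows the height above the parabola, so comparing tangents at a given
    abscissa amounts to comparing distances to their points of contact. *)
Lemma dot_tangent_le1 t p : (dot (tangent t) p <= 1) =
  (p ord0 ord_max <= 5 / 16 - p ord0 ord0 ^+ 2 + (p ord0 ord0 - t) ^+ 2).
Proof.
rewrite dot_tangent ler_pdivrMr ?tangent_den_gt0// mul1r.
by apply/idP/idP => ?; nra.
Qed.

Lemma dot_tangent_eq1 t p :
  p ord0 ord_max = 5 / 16 - p ord0 ord0 ^+ 2 + (p ord0 ord0 - t) ^+ 2 ->
  dot (tangent t) p = 1.
Proof.
rewrite dot_tangent => ->.
by apply: (canLR (mulfK (lt0r_neq0 (tangent_den_gt0 t)))); ring.
Qed.

Lemma tangent_inj : injective tangent.
Proof.
move=> t t' tt'.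
have := congr1 (fun u : plane R => u ord0 ord_max) tt'.
have := congr1 (fun u : plane R => u ord0 ord0) tt'.
rewrite !mxE /= !mulr1 => e den; move: e; rewrite den.
have den0 : (5 / 16 + t' ^+ 2)^-1 != 0.
  by rewrite invr_eq0 gt_eqF// tangent_den_gt0.
by move=> /(mulfI den0) e; lra.
Qed.

Lemma archP T p : arch T p <->
  [/\ - 4^-1 <= p ord0 ord0, p ord0 ord0 <= 4^-1, - 4^-1 <= p ord0 ord_max &
    forall t, t \in T ->
      p ord0 ord_max <= 5 / 16 - p ord0 ord0 ^+ 2 + (p ord0 ord0 - t) ^+ 2].
Proof.
split=> [Tp|[p0l p0r p1l Tp] u].
  have := Tp (pt (- 4) 0); have := Tp (pt 4 0); have := Tp (pt 0 (- 4)).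
  rewrite !dotE !ptE0 !ptE1 !mem_cat !inE !eqxx/= !orbT.
  move=> /(_ isT) ? /(_ isT) ? /(_ isT) ?; split; try lra.
  move=> t tT; rewrite -dot_tangent_le1; apply: Tp.
  by rewrite mem_cat map_f ?orbT.
rewrite mem_cat !inE => /orP[/or3P[]/eqP ->|/mapP[t tT ->]].
- by rewrite dotE ptE0 ptE1; lra.
- by rewrite dotE ptE0 ptE1; lra.
- by rewrite dotE ptE0 ptE1; lra.
- by rewrite dot_tangent_le1; exact: Tp.
Qed.

(** This is where [5 / 16] comes from: on the disc [y <= 1/4] and [x^2 <= 1/16], so the disc lies
    below the parabola, hence below every tangent. *)
Lemma edisc_arch T : edisc 0 4^-1 `<=` arch T.
Proof.
move=> p; rewrite /edisc /= /edistance sub0r => p4; apply/archP.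
have pp : p ord0 ord0 ^+ 2 + p ord0 ord_max ^+ 2 <= 16^-1.
  have := dotvv_ge0 (- p); move: p4; rewrite -ler_sqr ?nnegrE ?sqrtr_ge0//.
  move=> + pp0; rewrite sqr_sqrtr// dotE !mxE => ?; lra.
have bound (x y : R) : x ^+ 2 + y ^+ 2 <= 16^-1 -> - 4^-1 <= x <= 4^-1.
  move=> xy; rewrite -ler_norml -[leRHS]gtr0_norm// -ler_sqr_norm.
  by have := sqr_ge0 y; lra.
have /andP[? ?] := bound _ _ pp; rewrite addrC in pp.
have /andP[? ?] := bound _ _ pp; split => // t _.
have := sqr_ge0 (p ord0 ord0 - t); have := sqr_ge0 (p ord0 ord_max).
have := sqr_ge0 (p ord0 ord0); lra.
Qed.

(** Over the box, the tangent at [t] rises to at most [5/16 + 1/16 + 1/8]. *)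
Lemma arch_height T t p : t \in T -> - 4^-1 <= t <= 4^-1 -> arch T p ->
  p ord0 ord_max <= 2^-1.
Proof.
move=> tT /andP[t0 t1] /archP[p0 p1 _ /(_ t tT)]; nra.
Qed.

Lemma arch_convex_body T t : t \in T -> - 4^-1 <= t <= 4^-1 ->
  convex_body (arch T).
Proof.
move=> tT t4; split; last 1 first.
- by exists 0; apply: (@edisc_interior0 _ 4^-1) => //; exact: edisc_arch.
- apply: (@polar_compact _ _ 2^-1) => p Tp; have := arch_height tT t4 Tp.
  move/archP : Tp => [? ? ? _] ?; split; rewrite ler_norml; apply/andP; split; lra.
- exact: polar_convex.
Qed.

(** The arch fits in a box of width [1/2] and height [3/4], and [1/4 + 9/16 <= 1]. *)
Lemma arch_diameter T t : t \in T -> - 4^-1 <= t <= 4^-1 ->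
  (diameter (arch T) <= 1)%E.
Proof.
move=> tT t4; apply: ub_ereal_sup => _ [[p q] /= [Tp Tq] <-].
rewrite lee_fin /edistance -[leRHS]sqrtr1 ler_wsqrtr// dotE !mxE.
have := arch_height tT t4 Tp; have := arch_height tT t4 Tq.
move/archP : Tp => [? ? ? _]; move/archP : Tq => [? ? ? _] ? ?.
have : (p ord0 ord0 - q ord0 ord0) ^+ 2 <= (2^-1) ^+ 2.
  by rewrite ler_sqr_norm [leRHS]gtr0_norm// ler_norml; apply/andP; split; lra.
have : (p ord0 ord_max - q ord0 ord_max) ^+ 2 <= (3 / 4) ^+ 2.
  by rewrite ler_sqr_norm [leRHS]gtr0_norm// ler_norml; apply/andP; split; lra.
lra.
Qed.

Lemma arch_edge_lines d T : 0 < d -> spaced d T -> uniq T -> T != [::] ->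
  edge_lines (map polar_line (arch_normals T)) (arch T).
Proof.
move=> d0 [Tint Tsp] uT T0.
have [t0 t0T] : exists t, t \in T.
  by case: T T0 {Tint Tsp uT} => // t T; exists t; rewrite mem_head.
have pt_neq (x x' y y' : R) : x != x' -> pt x y != pt x' y'.
  by apply: contra_neq => /(congr1 (fun p : plane R => p ord0 ord0)); rewrite !ptE0.
have pt_neq' (x x' y y' : R) : y != y' -> pt x y != pt x' y'.
  by apply: contra_neq => /(congr1 (fun p : plane R => p ord0 ord_max)); rewrite !ptE1.
have Tint' t : t \in T -> - 4^-1 <= t <= 4^-1.
  by move=> /Tint/andP[? ?]; apply/andP; split; lra.
(* Over the vertical sides the parabola still has height [1/4], so no tangent cuts off these
   points. *)
have corner (x y : R) : x = 4^-1 \/ x = - 4^-1 -> - 4^-1 <= y -> y <= 0 -> arch T (pt x y).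
  move=> x4 y4 y0; apply/archP; rewrite ptE0 ptE1.
  by case: x4 => ->; split=> [| | |t _]; try lra; nra.
apply: polar_edge_lines.
- exact: arch_convex_body t0T (Tint' _ t0T).
- rewrite cat_uniq (map_inj_uniq tangent_inj) uT andbT; apply/andP; split.
    rewrite /= !inE !andbT negb_or; apply/andP; split.
      by rewrite !pt_neq//; apply/eqP; lra.
    by rewrite pt_neq//; apply/eqP; lra.
  apply/hasPn => _ /mapP[t tT ->]; apply/negP => tbox.
  have : 0 < tangent t ord0 ord_max.
    by rewrite mxE ptE1 mulr1 invr_gt0 tangent_den_gt0.
  by move: tbox; rewrite !inE => /or3P[]/eqP ->; rewrite ptE1; lra.
- move=> u; rewrite mem_cat !inE => /orP[/or3P[]/eqP ->|/mapP[t tT ->]].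
  + exists (pt (- 4^-1) 0), (pt (- 4^-1) (- 4^-1)).
    split; [apply: pt_neq'; apply/eqP; lra|apply: corner; lra|apply: corner; lra| |];
      rewrite dotE !ptE0 !ptE1; lra.
  + exists (pt 4^-1 0), (pt 4^-1 (- 4^-1)).
    split; [apply: pt_neq'; apply/eqP; lra|apply: corner; lra|apply: corner; lra| |];
      rewrite dotE !ptE0 !ptE1; lra.
  + exists (pt 4^-1 (- 4^-1)), (pt (- 4^-1) (- 4^-1)).
    split; [apply: pt_neq; apply/eqP; lra|apply: corner; lra|apply: corner; lra| |];
      rewrite dotE !ptE0 !ptE1; lra.
  (* At distance at most [d / 2] from [t], no other tangent is below the one at [t]. *)
  + pose e (x : R) := pt (t + x) (5 / 16 - (t + x) ^+ 2 + x ^+ 2).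
    have eT x : `|x| = d / 2 -> arch T (e x).
      move=> xd; have : - (d / 2) <= x <= d / 2 by rewrite -ler_norml xd.
      move=> /andP[x0 x1]; have /andP[t0' t1] := Tint _ tT.
      apply/archP; rewrite ptE0 ptE1; split; [lra|lra|nra|] => t' t'T.
      rewrite lerD2l ler_sqr_norm xd.
      have [<-|tt'] := eqVneq t t'; first by rewrite addrC addKr xd.
      have := Tsp _ _ tT t'T tt'; have := ler_normB (t + x - t') x.
      rewrite [t + x - t' - x](_ : _ = t - t'); last by ring.
      by rewrite xd; lra.
    have et x : dot (tangent t) (e x) = 1.
      by apply: dot_tangent_eq1; rewrite ptE0 ptE1; ring.
    exists (e (d / 2)), (e (- (d / 2))); split => //.
    * by apply: pt_neq; apply/eqP; lra.
    * by apply: eT; rewrite gtr0_norm// divr_gt0.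
    * by apply: eT; rewrite normrN gtr0_norm// divr_gt0.
Qed.

(** The point [d ^ 2] above the parabola at [t] lies below all tangents of [T'], but violates the
    tangent at [t] by [d ^ 2]. The normal [(2 t, 1)] has norm at most [3 / 2], whence
    [2 * e * (3 / 2)]. *)
Lemma arch_separation (e d : R) T T' K t : 0 < d -> 0 <= e ->
  eps_approximated e (arch T) K -> eps_approximated e (arch T') K ->
  t \in T -> - 4^-1 + d <= t <= 4^-1 - d ->
  (forall t', t' \in T' -> d <= `|t - t'|) -> d ^+ 2 <= 3 * e.
Proof.
move=> d0 e0 TK T'K tT /andP[t0 t1] T't.
pose p := pt t (5 / 16 - t ^+ 2 + d ^+ 2).
have T'p : arch T' p.
  apply/archP; rewrite ptE0 ptE1; split; [lra|lra|nra|] => t' /T't tt'.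
  by rewrite lerD2l ler_sqr_norm// gtr0_norm.
have Tc q : arch T q -> dot (pt (2 * t) 1) q <= 5 / 16 + t ^+ 2.
  by move=> /archP[_ _ _ /(_ t tT)]; rewrite dotE ptE0 ptE1; nra.
have := common_approx_separation T'K TK T'p Tc.
have uu : Num.sqrt (dot (pt (2 * t) 1) (pt (2 * t) 1)) <= 3 / 2.
  rewrite -[leRHS]gtr0_norm// -sqrtr_sqr ler_wsqrtr// dotE ptE0 ptE1; nra.
rewrite dotE !ptE0 !ptE1; have := sqrtr_ge0 (dot (pt (2 * t) 1) (pt (2 * t) 1)).
nra.
Qed.

End Arch.

(** * Averaging over the coins and counting memory states *)

Section Counting.
Context {R : realType} {d : measure_display} {W : measurableType d}.
Variable P : probability W R.

(** Double counting: the sum of the probabilities is the integral of the number of events that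
    occur. *)
Lemma sum_probability_le (I : finType) (E : I -> set W) (a : R) (k : nat) :
  (forall i, measurable (E i)) -> (forall i, (a%:E <= P (E i))%E) ->
  (forall w, (#|[pred i | w \in E i]| <= k)%N) ->
  #|I|%:R * a <= k%:R.
Proof.
move=> mE aE Ek; rewrite -lee_fin.
have -> : (#|I|%:R * a)%:E = (\sum_(i : I) a%:E)%E :> \bar R.
  by rewrite sumEFin sumr_const mulr_natl.
apply: (@le_trans _ _ (\sum_(i : I) P (E i))%E); first exact: lee_sum.
have -> : (\sum_(i : I) P (E i) = \int[P]_w \sum_(i : I) (\1_(E i) w)%:E)%E.
  rewrite ge0_integral_sum//=.
  + by apply: eq_bigr => i _; rewrite integral_indic ?setIT.
  + by move=> i; apply/measurable_EFinP; exact: measurable_indic.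
apply: (@le_trans _ _ (\int[P]_w (k%:R : R)%:E)%E).
  apply: ge0_le_integral => //.
  - by move=> w _; apply: sume_ge0 => i _; rewrite lee_fin.
  - by apply: emeasurable_sum => i; apply/measurable_EFinP; exact: measurable_indic.
  - move=> w _; rewrite sumEFin lee_fin.
    rewrite (eq_bigr (fun i => if w \in E i then 1 else 0)); last first.
      by move=> i _; rewrite indicE; case: (w \in E i).
    by rewrite -big_mkcond sumr_const ler_nat; exact: Ek.
rewrite integral_cst// -[leRHS]mule1 -(@probability_setT _ _ _ P)//.
Qed.

Lemma separated_family_card (I : finType) (s : nat) (A : stream_alg R W s)
    (eps rho : R) (D : set (set (plane R))) (N : nat)
    (K : I -> set (plane R)) (L : I -> seq (set (plane R))) :
  approximates_polygons P A eps rho D N ->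
  (forall i, [/\ D (K i), (diameter (K i) <= 1)%E, edge_lines (L i) (K i) &
     (size (L i) <= N)%N]) ->
  (forall i j K', eps_approximated eps (K i) K' ->
     eps_approximated eps (K j) K' -> i = j) ->
  #|I|%:R * (1 - rho) <= 2 ^+ s.
Proof.
move=> AP KL Kinj.
(* Success sets may fail to be measurable, so the averaging uses events chosen inside them. *)
have /choice[E EP] : forall i, exists E, [/\ measurable E, ((1 - rho)%:E <= P E)%E &
    E `<=` [set w | eps_approximated eps (K i) (sa_result A w (L i))]].
  move=> i; have [DK dK eK sL] := KL i.
  by have [E [mE PE] EA] := AP _ _ DK dK eK sL; exists E.
rewrite -natrX; apply: (@sum_probability_le _ E).
- by move=> i; case: (EP i).
- by move=> i; case: (EP i).
(* For fixed coins the output depends only on the final state; two successful inputs with the same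
   state would share an approximation, so [f] is injective on them. *)
move=> w; pose f i := sa_run A w 0 (sa_init A w) (L i).
rewrite -(@card_in_imset _ _ f).
  by rewrite (leq_trans (max_card _))// card_tuple card_bool.
move=> i j; rewrite !inE => wi wj fij; have [_ _ Ei] := EP i; have [_ _ Ej] := EP j.
apply: (Kinj _ _ (sa_output A w (f i))); first exact: Ei.
by rewrite fij; exact: Ej.
Qed.

End Counting.

(** * Equally spaced abscissae and the resulting space bound *)

Section Nodes.
Context {R : realType}.
Variable m : nat.
Implicit Types (i j : 'I_m.+1) (S : {set 'I_m.+1}).

(** An interval of length [1/2] is cut into [m + 2] equal steps, which leaves [m + 1] interior
    nodes. *)
Definition gap : R := (2 * m.+2%:R)^-1.

Definition node (i : 'I_m.+1) : R := - 4^-1 + i.+1%:R * gap.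

Definition nodes (S : {set 'I_m.+1}) : seq R := map node (enum S).

Lemma gap_gt0 : 0 < gap.
Proof. by rewrite invr_gt0 mulr_gt0. Qed.

Lemma gapM : m.+2%:R * gap = 2^-1.
Proof. by rewrite /gap invfM mulrCA mulfV ?mulr1// pnatr_eq0. Qed.

Lemma node_itv i : - 4^-1 + gap <= node i <= 4^-1 - gap.
Proof.
have g0 := gap_gt0; have gM := gapM; rewrite /node; apply/andP; split.
  by rewrite lerD2l ler_peMl ?(ltW g0)// ler1n.
have : i.+1%:R * gap <= m.+1%:R * gap :> R.
  by rewrite ler_wpM2r ?(ltW g0)// ler_nat.
by move: gM; rewrite -(natr1 m.+1) mulrDl mul1r; lra.
Qed.

Lemma node_dist i j : i != j -> gap <= `|node i - node j|.
Proof.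
have g0 := gap_gt0; wlog ij : i j / (i < j)%N => [wlog_ij|_].
  move=> ij; case: (ltngtP i j) => [lt_ij|lt_ji|/val_inj eq_ij].
  - exact: wlog_ij.
  - by rewrite distrC; apply: wlog_ij; rewrite // eq_sym.
  - by move: ij; rewrite eq_ij eqxx.
rewrite distrC ger0_norm /node opprD addrACA addrN add0r -mulrBl.
  by rewrite ler_peMl ?(ltW g0)// -natrB ?ler1n ?subn_gt0// ltnW.
by rewrite mulr_ge0 ?(ltW g0)// subr_ge0 ler_nat ltnW.
Qed.

Lemma node_inj : injective node.
Proof.
move=> i j ij; apply/eqP/negP => /negP /node_dist.
by rewrite ij subrr normr0 leNgt gap_gt0.
Qed.

Lemma nodesP S (t : R) : reflect (exists2 i, i \in S & t = node i) (t \in nodes S).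
Proof.
by apply: (iffP mapP) => -[i iS ->]; exists i => //; rewrite ?mem_enum// -mem_enum.
Qed.

Lemma nodes_spaced S : spaced gap (nodes S).
Proof.
split=> [t /nodesP[i _ ->]|t t' /nodesP[i _ ->] /nodesP[j _ ->] ij].
  exact: node_itv.
by apply: node_dist; apply: contra_neq ij => ->.
Qed.

(** A node of [S] outside [S'] is at least [gap] away from all nodes of [S'], which
    [arch_separation] forbids. *)
Lemma arch_nodes_sub (e : R) S S' K : 0 <= e -> 3 * e < gap ^+ 2 ->
  eps_approximated e (arch (nodes S)) K ->
  eps_approximated e (arch (nodes S')) K -> S \subset S'.
Proof.
move=> e0 eg SK S'K; apply/fintype.subsetP => i iS; apply/negP => /negP iS'.
suff : gap ^+ 2 <= 3 * e by rewrite leNgt eg.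
apply: (arch_separation gap_gt0 e0 SK S'K (t := node i)).
- by apply/nodesP; exists i.
- exact: node_itv.
- move=> _ /nodesP[j jS' ->]; apply: node_dist.
  by apply: contraNneq iS' => ->.
Qed.

Lemma space_lower_bound (eps : R) (D : set (set (plane R))) (s : nat)
    (d : measure_display) (W : measurableType d) (P : probability W R)
    (A : stream_alg R W s) :
  0 <= eps -> 3 * eps < gap ^+ 2 -> covers_fat_bodies D ->
  approximates_polygons P A eps 3^-1 D (2 * m.+4) -> (m <= s)%N.
Proof.
move=> eps0 epsg Dfat AP.
(* The empty set is left out: without tangents the arch is unbounded above. *)
pose I := {S : {set 'I_m.+1} | S != finset.set0}.
have Icard : #|{: I}| = (2 ^ m.+1).-1.
  rewrite card_sig (_ : #|_| = #|predC1 (finset.set0 : {set 'I_m.+1})|)//.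
  by rewrite cardC1 -cardsT -powersetT card_powerset cardsT card_ord.
have : #|{: I}|%:R * (1 - 3^-1) <= 2 ^+ s :> R.
  apply: (separated_family_card (K := fun S : I => arch (nodes (val S)))
    (L := fun S : I => map polar_line (arch_normals (nodes (val S)))) AP).
    move=> [S S0] /=; have [i iS] := finset.set0Pn _ S0.
    have tS : node i \in nodes S by apply/nodesP; exists i.
    have /andP[? ?] := node_itv i; have g0 := gap_gt0.
    have t4 : - 4^-1 <= node i <= 4^-1 by apply/andP; split; lra.
    split.
    - by apply: Dfat; [exact: arch_convex_body tS t4 | exact: edisc_arch].
    - exact: arch_diameter tS t4.
    - apply: (arch_edge_lines gap_gt0 (nodes_spaced S)).
        by rewrite map_inj_uniq ?enum_uniq//; exact: node_inj.
      by apply/eqP => S00; rewrite S00 in tS.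
    - rewrite size_map /= !size_map -cardE.
      have Sm : (#|S| <= m.+1)%N by rewrite -[leqRHS]card_ord max_card.
      (* Three sides of the box and at most [m + 1] tangents. *)
      by apply: (@leq_ltn_trans m.+3); [exact: Sm | lia].
  move=> S S' K SK S'K; apply/val_inj/eqP; rewrite finset.eqEsubset.
  by rewrite !(arch_nodes_sub eps0 epsg SK S'K, arch_nodes_sub eps0 epsg S'K SK).
(* If [s < m], then [2 ^ (m + 1) - 1 >= 4 * 2 ^ s - 1], and two thirds of this exceed [2 ^ s]. *)
rewrite Icard; apply: contraTT; rewrite -ltnNge -ltNge => sm; rewrite -natrX.
have : (2 ^ s * 2 <= 2 ^ m)%N by rewrite -expnSr leq_exp2l.
have : (0 < 2 ^ s)%N by rewrite expn_gt0.
rewrite expnS; move: (2 ^ s)%N (2 ^ m)%N => a b a0 ab.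
rewrite (_ : 1 - 3^-1 = 2 / 3 :> R); last by lra.
rewrite mulrA ltr_pdivlMr// -!natrM ltr_nat; lia.
Qed.

End Nodes.

Theorem theorem9 (R : realType) :
  exists2 c : R, 0 < c &
  forall eps : R, 0 < eps ->
  exists2 n : nat, (0 < n)%N &
  forall (D : set (set (plane R))) (s : nat)
         (d : measure_display) (W : measurableType d) (P : probability W R)
         (A : stream_alg R W s),
    covers_fat_bodies D ->
    (0 < s)%N ->
    approximates_polygons P A eps 3^-1 D (2 * n) ->
    c / Num.sqrt eps <= s%:R.
Proof.
(* [11 > 3 * sqrt 12], where [m + 2 <= 3 m] and [gap = 1 / (2 (m + 2))] must
   exceed [sqrt (3 eps)]; the further factor 2 comes from [m + 1 <= 2 s]. *)
exists 22^-1 => // eps eps0; pose x := (Num.sqrt eps)^-1.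
have q0 : 0 < Num.sqrt eps by rewrite sqrtr_gt0.
have x0 : 0 < x by rewrite invr_gt0.
have xeps : x ^+ 2 * eps = 1.
  by rewrite exprVn sqr_sqrtr ?(ltW eps0)// mulVf// gt_eqF.
pose m := Num.truncn (x / 11).
have /andP[mx xm] : m%:R <= x / 11 < m.+1%:R.
  by apply: truncn_itv; rewrite divr_ge0// ltW.
exists m.+4 => // D s d W P A Dfat s0 AP.
have ms : (m <= s)%N.
  (* For [m = 0], [eps] may be too large for [gap], but the claim is then trivial. *)
  have [->//|m0] := posnP m.
  apply: space_lower_bound (ltW eps0) _ Dfat AP.
  rewrite /gap exprVn -[ltRHS]mul1r.
  rewrite ltr_pdivlMr ?exprn_gt0 ?mulr_gt0//.
  have mm : m.+2%:R <= 3 * m%:R :> R by rewrite -natrM ler_nat; lia.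
  have m2 : 0 < m.+2%:R :> R by [].
  have : m.+2%:R ^+ 2 <= (3 * (x / 11)) ^+ 2 by rewrite ler_sqr ?nnegrE; lra.
  nra.
have : m.+1%:R <= 2 * s%:R :> R by rewrite -natrM ler_nat; lia.
rewrite -/x; lra.
Qed.
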